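(* Suppose $0<p<q<\infty$ and $q\ge1$, and let $1/\alpha=1/p-1/q$. Let $x=(x_k)_{k=1}^\infty\in\ell^q$ and $y=(y_k)_{k=1}^\infty\in\ell^q$ be two sequences such that for all $n\in\mathbb{N}$ $$\Big(\sum_{k=1}^{n}(y_k^* )^p\Big)^{1/p}+n^{1/\alpha}\Big(\sum_{k=n}^{\infty}(y_k^* )^q\Big)^{1/q}\le\Big(\sum_{k=1}^{n}(x_k^* )^p\Big)^{1/p}+n^{1/\alpha}\Big(\sum_{k=n}^{\infty}(x_k^* )^q\Big)^{1/q}.$$ Then there exist linear operators $T:\ell^\infty\to\ell^\infty$ and $S:\ell^q\to\ell^q$ such that $\|T\|_{\mathfrak{L}(\ell^p,\ell^\infty)}\le 8^{1/p}$, $\|S\|_{\mathfrak{L}(\ell^0,\ell^q)}\le18$ and $y=Tx+Sx$.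
   Context: All sequences are real. For $0<p<\infty$, $\|x\|_{\ell^p}=(\sum_k|x_k|^p)^{1/p}$; $\ell^\infty$ has the sup norm; $\ell^0$ is the linear space of eventually zero sequences with $\|x\|_{\ell^0}:=\mathrm{card}\{k:x_k\ne0\}$. For a bounded sequence $u$, $(u_k^* )$ denotes the nonincreasing rearrangement of $(|u_k|)$: $u_k^*:=\inf_{\mathrm{card}A=k-1}\sup_{i\in\mathbb{N}\setminus A}|u_i|$. Put $\|T\|_{X\to X}:=\sup_{x\ne0}\|Tx\|_X/\|x\|_X$. For $0\le p<q\le\infty$, $\mathfrak{L}(\ell^p,\ell^q)$ is the set of bounded linear operators $T$ on $\ell^q$ whose restriction to $\ell^p$ is a bounded map of $\ell^p$ into itself, and $\|T\|_{\mathfrak{L}(\ell^p,\ell^q)}:=\max(\|T\|_{\ell^p\to\ell^p},\|T\|_{\ell^q\to\ell^q})$. *)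

(* Defs.v *)
From HB Require Import structures.
From mathcomp Require Export all_boot all_order all_algebra.
From mathcomp Require Export all_classical all_reals all_analysis.
Export Order.TTheory GRing.Theory Num.Theory.
Export numFieldNormedType.Exports.

Set Implicit Arguments.
Unset Strict Implicit.
Unset Printing Implicit Defensive.

Local Open Scope classical_set_scope.
Local Open Scope ring_scope.

(* The library's [Lnorm] treats the exponent 0 by its generic formula, whereas
   the l^0 "norm" is the size of the support ([+oo] when that is infinite).
   Exponents below 1 give the usual quasi-norm. *)
Definition lnorm (R : realType) (p : \bar R) (u : R^nat) : \bar R :=
  if p == 0%E then counting [set k | u k != 0]
  else Lnorm counting p (EFin \o u).

Definition ell (R : realType) (p : \bar R) : set (R^nat) :=
  [set u | (lnorm p u < +oo)%E].

(* Positions k >= 1, so that [rearr u 1] is the supremum of |u|; the sequence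
   [u] itself is indexed from 0. Meaningful for bounded [u] only, since [sup]
   of an unbounded set is 0. *)
Definition rearr (R : realType) (u : R^nat) (k : nat) : R :=
  inf [set sup [set `|u i| | i in ~` A] | A in [set A : set nat | (A #= `I_k.-1)%card]].

Definition opnorm (R : realType) (p : \bar R) (T : R^nat -> R^nat) : \bar R :=
  ereal_sup [set (lnorm p (T u) / lnorm p u)%E
            | u in [set u : R^nat | ell p u /\ u != 0]].

(* An operator on l^p is represented by a map on all sequences, of which only
   the values on l^p matter. *)
Definition linear_on (R : realType) (p : \bar R) (T : R^nat -> R^nat) : Prop :=
  (forall u, ell p u -> ell p (T u)) /\
  (forall (a : R) (u v : R^nat), ell p u -> ell p v ->
     T (a *: u + v) = a *: T u + T v).

Definition bounded_on (R : realType) (p : \bar R) (T : R^nat -> R^nat) : Prop :=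
  linear_on p T /\ (opnorm p T < +oo)%E.

Definition couple_bounded (R : realType) (p q : \bar R) : set (R^nat -> R^nat) :=
  [set T | bounded_on q T /\ bounded_on p T].

Definition couple_norm (R : realType) (p q : \bar R) (T : R^nat -> R^nat) :
    \bar R :=
  maxe (opnorm p T) (opnorm q T).

(* The extended-real series has nonnegative terms, so its value is [+oo]
   exactly when it diverges. *)
Definition head_tail (R : realType) (p q alpha : R) (u : R^nat) (n : nat) :
    \bar R :=
  (((\sum_(1 <= k < n.+1) rearr u k `^ p) `^ p^-1)%:E +
   (n%:R `^ alpha^-1)%:E *
   (\sum_(n <= k <oo) (rearr u k `^ q)%:E) `^ q^-1)%E.

(* Main.v *)
Require Import Defs.
From mathcomp Require Import ess_sup_inf ring lra zify.

(** Write a and b for the nonincreasing rearrangements of |x| and |y|, indexed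
    from 0. Since x and y tend to 0, they are enumerated by injections sx and
    sy with a k = |x (sx k)| and b k = |y (sy k)|, up to places where the
    sequence vanishes ([decreasing_enumeration]). Moving between x and a, or
    between b and y, is done by weighted composition operators that are
    contractions for every exponent ([wcomp_contraction]), so it is enough to
    write b = T a + S a.

    The hypothesis at n = k+1 compares two sums of a head term and a tail term.
    Hence for each k either the head inequality
      sum_{i <= k} (b i)^p <= sum_{i <= k} (a i)^p
    holds, or the tail inequality
      sum_{i >= k} (b i)^q <= sum_{i >= k} (a i)^q
    does. T produces the entries b k of the first kind and S the others.

    Heads: place intervals of lengths 2 (a j)^p, and intervals of lengths
    (b k)^p, end to end on the half-line, and send k to the index j of the
    interval of a that contains the left end of the k-th interval of b
    ([head_assignment]). Monotonicity and the head inequality at k give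
    (b k)^p <= 2 (a j)^p, so the entries sent to j have total p-th power at
    most 4 (a j)^p. Therefore u |-> (b k / a j(k)) u_j(k) is bounded both on
    l^p and on l^oo.

    Tails: if (b k)^q <= 2 (a k)^q, take b k from a k alone. Otherwise lay the
    q-th powers end to end starting from infinity, and take b k from the block
    of all j for which the interval of a ends well inside the k-th interval of
    b. By the tail inequality this block contains no index before k, so its
    intervals are less than half as long as that of b, and they fill a fixed
    proportion of it ([tail_assignment]). Blocks of different k are disjoint,
    so each j serves at most two entries: one through its block, one through
    k = j. Averaging over the blocks is bounded on l^q by convexity of t^q,
    which is where q >= 1 enters, and it at most doubles supports. *)

Set Implicit Arguments.
Unset Strict Implicit.
Unset Printing Implicit Defensive.

Local Open Scope classical_set_scope.
Local Open Scope ring_scope.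

(** * Norms as series *)

Lemma lnormE (R : realType) (p : R) (u : R^nat) : 0 < p ->
  lnorm p%:E u = ((\sum_(k <oo) ((`|u k| `^ p)%R)%:E) `^ p^-1)%E.
Proof.
by move=> p0; rewrite /lnorm eqe gt_eqF// Lnorm_counting.
Qed.

Lemma lnorm0E (R : realType) (u : R^nat) :
  lnorm 0%E u = (\sum_(k <oo) ((u k != 0)%:R)%:E)%E.
Proof.
rewrite /lnorm eqxx counting_dirac; apply: eq_eseriesr => k _.
rewrite diracE; congr (_%:R)%:E; congr nat_of_bool.
case: (boolP (u k != 0)) => uk; first exact: mem_set.
by apply: memNset; apply/negP.
Qed.

Lemma counting_gt0 (R : realType) (A : set nat) k : A k ->
  (0 < counting A :> \bar R)%E.
Proof.
move=> Ak; rewrite counting_dirac (@nneseriesD1 _ _ k)//.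
rewrite diracE mem_set//= (@lt_le_trans _ _ 1%E) ?lte01// leeDl//.
exact: nneseries_ge0.
Qed.

(** Points have positive counting measure, so the essential supremum is a
    genuine supremum. *)
Lemma lnormyP (R : realType) (u : R^nat) (M : \bar R) :
  reflect (forall k, (`|u k|%:E <= M)%E) (lnorm +oo%E u <= M)%E.
Proof.
have c0 : (0 < counting [set: nat] :> \bar R)%E by apply: (@counting_gt0 _ _ 0).
rewrite /lnorm /= unlock c0.
apply: (iffP (@ess_supP _ _ _ _ _ _)) => [|h]; last first.
  by apply: nearW => k; exact: h.
move=> [N [mN N0 hN]] k; apply/negP => hk.
have Nk : N k by apply: hN.
by have := counting_gt0 R Nk; rewrite N0 ltxx.
Qed.

(** Makes the quotient in [opnorm] one by a positive finite number, so that it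
    can be cleared. *)
Lemma lnorm_gt0 (R : realType) (p : \bar R) (u : R^nat) :
  (0 <= p)%E -> u != 0 -> (0 < lnorm p u)%E.
Proof.
move=> p0 u0; have [k uk] : exists k, u k != 0.
  apply: contrapT => h; move/eqP: u0; apply; apply/funext => k.
  by apply/eqP/negPn/negP => uk; apply: h; exists k.
case: p p0 => [p|_|//]; last first.
  rewrite ltNge; apply/negP => /lnormyP /(_ k).
  by rewrite lee_fin normr_le0 (negPf uk).
rewrite lee_fin le_eqVlt => /predU1P[<-|p0].
  rewrite lnorm0E; apply: lt_le_trans (nneseries_lim_ge k.+1 _); last first.
    by move=> *; rewrite lee_fin.
  rewrite sumEFin lte_fin big_nat_recr//= uk.
  by rewrite ltr_wpDl// sumr_ge0.
rewrite lnormE//; apply: poweR_gt0.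
apply: lt_le_trans (nneseries_lim_ge k.+1 _); last first.
  by move=> *; rewrite lee_fin powR_ge0.
rewrite sumEFin lte_fin big_nat_recr//=.
by rewrite ltr_wpDl ?sumr_ge0 ?powR_gt0 ?normr_gt0// => *; exact: powR_ge0.
Qed.

Lemma opnorm_le (R : realType) (p : \bar R) (C : R) (T : R^nat -> R^nat) :
    (0 <= p)%E -> (forall u, lnorm p (T u) <= C%:E * lnorm p u)%E ->
  (opnorm p T <= C%:E)%E.
Proof.
move=> p0 TC; apply: ge_ereal_sup => _ [u [/= pu u0] <-].
have := lnorm_gt0 p0 u0; have := TC u.
move: pu; rewrite /ell /=; case: (lnorm p u) => [r _ h|//|//].
rewrite lte_fin => r0; rewrite inver gt_eqF//.
by rewrite lee_pdivrMr.
Qed.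

Lemma bounded_onI (R : realType) (p : \bar R) (C : R) (T : R^nat -> R^nat) :
    (0 <= p)%E -> 0 <= C ->
    (forall (a : R) u v, T (a *: u + v) = a *: T u + T v) ->
    (forall u, lnorm p (T u) <= C%:E * lnorm p u)%E ->
  bounded_on p T.
Proof.
move=> p0 C0 linT TC; split; last first.
  by apply: le_lt_trans (opnorm_le p0 TC) _; rewrite ltry.
split=> [u pu|a u v _ _]; last exact: linT.
rewrite /ell /=; apply: le_lt_trans (TC u) _.
by apply: lte_mul_pinfty => //; rewrite ?lee_fin.
Qed.

(** * Bounds from column sums *)

(** Exchange the two sums. Rows are finite, so that only finite sums are
    exchanged; N k is the length of row k. Stated for nonnegative sequences, it
    serves the l^p norms, with |u k|^p, and the l^0 norm, with the indicator of
    u k != 0. *)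
Lemma schur_test (R : realType) (f g : R^nat) (c : nat -> nat -> R)
    (N : nat -> nat) (C : R) :
    (forall k, 0 <= g k) -> (forall k j, 0 <= c k j) ->
    (forall k, f k <= \sum_(j < N k) c k j * g j) ->
    (forall k, 0 <= f k) ->
    (forall n j, \sum_(k < n) c k j <= C) ->
  (\sum_(k <oo) (f k)%:E <= C%:E * \sum_(k <oo) (g k)%:E)%E.
Proof.
move=> g0 c0 fle f0 cC.
have C0 : 0 <= C by have := cC 0 0; rewrite big_ord0.
apply: lime_le; first by apply: is_cvg_nneseries => *; rewrite lee_fin.
apply: nearW => n; rewrite sumEFin big_mkord.
set M := \max_(k < n) N k.
apply: (@le_trans _ _ (C * \sum_(j < M) g j)%:E); last first.
  rewrite EFinM lee_wpmul2l ?lee_fin//.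
  have := @nneseries_lim_ge R (fun k => (g k)%:E) xpredT 0 M.
  by rewrite sumEFin big_mkord; apply=> *; rewrite lee_fin.
rewrite lee_fin.
apply: (@le_trans _ _ (\sum_(k < n) \sum_(j < M) c k j * g j)).
  apply: ler_sum => k _; apply: le_trans (fle k) _.
  rewrite -!(big_mkord xpredT (fun j => c k j * g j)).
  have kM : (N k <= M)%N by apply: (leq_bigmax k).
  rewrite [leRHS](big_cat_nat (leq0n _) kM)//=.
  by rewrite lerDl sumr_ge0// => j _; rewrite mulr_ge0.
rewrite exchange_big mulr_sumr; apply: ler_sum => j _ /=.
by rewrite -mulr_suml ler_wpM2r ?g0 ?cC.
Qed.

Lemma schur_lnorm (R : realType) (p : R) (u v : R^nat) (c : nat -> nat -> R)
    (N : nat -> nat) (C : R) : 0 < p ->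
    (forall k j, 0 <= c k j) ->
    (forall k, `|v k| `^ p <= \sum_(j < N k) c k j * `|u j| `^ p) ->
    (forall n j, \sum_(k < n) c k j <= C) ->
  (lnorm p%:E v <= (C `^ p^-1)%:E * lnorm p%:E u)%E.
Proof.
move=> p0 c0 vu cC; rewrite !lnormE//.
have C0 : 0 <= C by have := cC 0 0; rewrite big_ord0.
have s0 (w : R^nat) : (0 <= \sum_(k <oo) ((`|w k| `^ p)%R)%:E)%E.
  by apply: nneseries_ge0 => *; rewrite lee_fin powR_ge0.
rewrite -poweR_EFin -poweRM// ?lee_fin//.
apply: gt0_ler_poweR.
- by rewrite invr_ge0 ltW.
- by rewrite in_itv/= leey andbT; exact: s0.
- by rewrite in_itv/= leey andbT mule_ge0 ?lee_fin ?s0.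
- by apply: (schur_test (N := N)) vu _ cC => // *; rewrite powR_ge0.
Qed.

(** * Weighted composition operators *)

Definition wcomp (R : realType) (a : R^nat) (tau : nat -> nat) (u : R^nat) :
  R^nat := fun k => a k * u (tau k).

Lemma wcomp_linear (R : realType) (a : R^nat) (tau : nat -> nat) (b : R)
    (u v : R^nat) :
  wcomp a tau (b *: u + v) = b *: wcomp a tau u + wcomp a tau v.
Proof. by apply/funext => k; rewrite /wcomp !fctE/= mulrDr mulrCA. Qed.

Lemma sum_pick (R : realType) (m : nat) (x : R) (g : R^nat) :
  \sum_(j < m.+1) (if m == j then x else 0) * g j = x * g m.
Proof.
rewrite big_ord_recr /= eqxx big1 ?add0r// => j _.
by rewrite gtn_eqF ?mul0r.
Qed.

(** In the matrix of [wcomp a tau] each row has one nonzero entry, so the p-th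
    powers of its entries satisfy the column test. *)
Lemma wcomp_lnorm (R : realType) (p C : R) (a : R^nat)
    (tau : nat -> nat) (u : R^nat) : 0 < p ->
    (forall n j, \sum_(k < n | tau k == j) `|a k| `^ p <= C) ->
  (lnorm p%:E (wcomp a tau u) <= (C `^ p^-1)%:E * lnorm p%:E u)%E.
Proof.
move=> p0 aC.
apply: (schur_lnorm (c := fun k j => if tau k == j then `|a k| `^ p else 0)
  (N := fun k => (tau k).+1)) => //.
- by move=> k j; case: ifP => // _; exact: powR_ge0.
- by move=> k; rewrite (sum_pick _ _ (fun j => `|u j| `^ p)) normrM powRM.
- by move=> n j; rewrite -big_mkcond.
Qed.

Lemma wcomp_lnorm0 (R : realType) (C : R) (a : R^nat)
    (tau : nat -> nat) (u : R^nat) :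
    (forall n j, \sum_(k < n | tau k == j) (a k != 0)%:R <= C) ->
  (lnorm 0%E (wcomp a tau u) <= C%:E * lnorm 0%E u)%E.
Proof.
move=> aC; rewrite !lnorm0E.
apply: (schur_test (c := fun k j => if tau k == j then (a k != 0)%:R else 0)
  (N := fun k => (tau k).+1)) => //.
- by move=> k j; case: ifP.
- move=> k; rewrite (sum_pick _ _ (fun j => (u j != 0)%:R)) /wcomp.
  by rewrite mulf_eq0 negb_or; do 2 case: (_ == 0); rewrite ?mulr0 ?mulr1.
- by move=> n j; rewrite -big_mkcond.
Qed.

Lemma wcomp_lnormy (R : realType) (C : R) (a : R^nat)
    (tau : nat -> nat) (u : R^nat) :
    0 <= C -> (forall k, `|a k| <= C) ->
  (lnorm +oo%E (wcomp a tau u) <= C%:E * lnorm +oo%E u)%E.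
Proof.
move=> C0 aC; apply/lnormyP => k; rewrite /wcomp normrM EFinM.
apply: lee_pmul; rewrite ?lee_fin//.
by have /lnormyP := lexx (lnorm +oo%E u).
Qed.

Lemma sum_indicator_le1 (R : realType) (P : pred nat) n :
    (forall k l, P k -> P l -> k = l) ->
  \sum_(k < n) (P k)%:R <= 1 :> R.
Proof.
move=> inj; elim: n => [|n ih]; first by rewrite big_ord0.
rewrite big_ord_recr /=; case Pn : (P n); last by rewrite addr0.
rewrite big1 ?add0r// => k _; case Pk : (P k) => //.
by have := inj _ _ Pn Pk; have := ltn_ord k; lia.
Qed.

(** Signed rearrangements: this covers the passage from a sequence to its
    nonincreasing rearrangement and back, at all exponents at once. *)
Lemma wcomp_contraction (R : realType) (a : R^nat)
    (tau : nat -> nat) (p : \bar R) (u : R^nat) :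
    (0 <= p)%E -> (forall k, `|a k| <= 1) ->
    (forall k l, a k != 0 -> a l != 0 -> tau k = tau l -> k = l) ->
  (lnorm p (wcomp a tau u) <= lnorm p u)%E.
Proof.
move=> p0 a1 inj.
have aj n j : \sum_(k < n | tau k == j) (a k != 0)%:R <= 1 :> R.
  rewrite big_mkcond /=.
  rewrite (eq_bigr (fun k : 'I_n => ((tau k == j) && (a k != 0))%:R));
    last by move=> k _; case: (tau k == j).
  apply: (@sum_indicator_le1 _ (fun k => (tau k == j) && (a k != 0))).
  move=> k l /andP[/eqP tk ak] /andP[/eqP tl al].
  by apply: inj => //; rewrite tk tl.
rewrite -[leRHS]mul1e; case: p p0 => [p|_|//]; last exact: wcomp_lnormy.
rewrite lee_fin le_eqVlt => /predU1P[<-|p0]; first exact: wcomp_lnorm0.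
have <- : 1 `^ p^-1 = 1 :> R by rewrite powR1.
apply: wcomp_lnorm => // n j.
apply: le_trans (aj n j); apply: ler_sum => k _.
have [->|ak] := eqVneq (a k) 0; first by rewrite normr0 powR0 ?gt_eqF.
have <- : 1 `^ p = 1 :> R by rewrite powR1.
by rewrite ge0_ler_powR ?nnegrE// ltW.
Qed.

(** * Assigning entries under head domination *)

Definition psum (R : realType) (A : R^nat) (n : nat) : R := \sum_(k < n) A k.

Lemma psum0 (R : realType) (A : R^nat) : psum A 0 = 0.
Proof. by rewrite /psum big_ord0. Qed.

Lemma psumS (R : realType) (A : R^nat) n : psum A n.+1 = psum A n + A n.
Proof. by rewrite /psum big_ord_recr. Qed.

Lemma psum_ge (R : realType) (A : R^nat) n :
  (forall m n, (m <= n)%N -> A n <= A m) -> n.+1%:R * A n <= psum A n.+1.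
Proof.
move=> dA; have -> : n.+1%:R * A n = \sum_(k < n.+1) A n.
  by rewrite sumr_const card_ord mulr_natl.
by apply: ler_sum => k _; apply: dA; rewrite -ltnS.
Qed.

Lemma psum_le (R : realType) (A : R^nat) j n :
  (forall m n, (m <= n)%N -> A n <= A m) -> (forall k, 0 <= A k) ->
  psum A n <= psum A j + n%:R * A j.
Proof.
move=> dA A0; elim: n => [|n ih].
  by rewrite psum0 mul0r addr0 sumr_ge0.
have [nj|jn] := ltnP n j.
  apply: (@le_trans _ _ (psum A j)); last by rewrite lerDl mulr_ge0.
  rewrite /psum -!(big_mkord xpredT A) [leRHS](big_cat_nat (leq0n _) nj)//=.
  by rewrite lerDl sumr_ge0.
rewrite psumS -natr1 mulrDl mul1r addrA lerD//.
exact: dA.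
Qed.

(** Entries that vanish need no preimage, hence the condition on B k. *)
Definition head_dominated (R : realType) (A B : R^nat) (k : nat) : bool :=
  (0 < B k) && (psum B k.+1 <= psum A k.+1).

(** The index tau k is the least j with psum B k < 2 psum A (j+1), that is the
    interval of the layout 2 A 0, 2 A 1, ... containing the left end of the
    k-th interval of B. The entry fits, B k <= 2 A (tau k), since with j = tau k
      psum B (k+1) <= psum A (k+1) <= psum A j + (k+1) A j
                   <= psum B (k+1) / 2 + (k+1) A j
    and (k+1) B k <= psum B (k+1) by monotonicity. The entries sent to j start
    inside an interval of length 2 A j and the last of them sticks out by at
    most 2 A j, whence the bound 4 A j. *)
Lemma head_assignment (R : realType) (A B : R^nat) :
    (forall k, 0 <= A k) -> (forall k, 0 <= B k) ->
    (forall m n, (m <= n)%N -> A n <= A m) ->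
    (forall m n, (m <= n)%N -> B n <= B m) ->
  exists tau : nat -> nat,
    (forall k, head_dominated A B k -> 0 < A (tau k) /\ B k <= 2 * A (tau k)) /\
    (forall n j,
       \sum_(k < n | head_dominated A B k && (tau k == j)) B k <= 4 * A j).
Proof.
move=> A0 B0 dA dB.
have spec k : exists j, head_dominated A B k ->
    2 * psum A j <= psum B k < 2 * psum A j.+1.
  have [/andP[Bk HBA]|_] := boolP (head_dominated A B k); last by exists 0%N.
  have Aex : exists j, psum B k < 2 * psum A j.+1.
    exists k; move: HBA; rewrite psumS => HBA.
    have : 0 <= psum B k by exact: sumr_ge0.
    lra.
  exists (ex_minn Aex) => _; case: ex_minnP => -[h0 _|j hj jmin].
    by rewrite h0 psum0 mulr0 sumr_ge0.
  rewrite hj andbT leNgt; apply/negP => /jmin.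
  by rewrite ltnn.
have [tau htau] := choice spec.
have big_bin k : head_dominated A B k -> B k <= 2 * A (tau k).
  move=> gk; have /andP[lo hi] := htau k gk; case/andP: gk => Bk HBA.
  have h1 := psum_ge k dB.
  have h2 := psum_le (tau k) k.+1 dA A0.
  have k0 : 0 < k.+1%:R :> R by rewrite ltr0n.
  rewrite -(ler_pM2l k0) mulrCA.
  move: HBA h1; rewrite psumS => HBA h1.
  lra.
exists tau; split=> [k gk|n j].
  have /andP[Bk _] := gk; have := big_bin k gk; split=> //; lra.
(* Entries sent to j lie to the right of the left end of the j-th interval. *)
have load m : \sum_(k < m | head_dominated A B k && (tau k == j)) B k <=
    Num.max 0 (psum B m - 2 * psum A j).
  elim: m => [|m ih]; first by rewrite big_ord0 le_max lexx.
  rewrite big_mkcond big_ord_recr -big_mkcond /=.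
  have Bm := B0 m; rewrite psumS.
  case: ifPn => [/andP[gm /eqP tm]|_].
    have /andP[lo _] := htau m gm; rewrite tm in lo.
    move: ih; rewrite !maxEle; case: ifP; case: ifP; lra.
  move: ih; rewrite !maxEle; case: ifP; case: ifP; lra.
elim: n => [|n ih]; first by rewrite big_ord0 mulr_ge0.
rewrite big_mkcond big_ord_recr -big_mkcond /=.
case: ifPn => [/andP[gn /eqP tn]|_]; last by rewrite addr0.
have := load n; have /andP[lo hi] := htau n gn; have := big_bin n gn.
rewrite tn psumS in lo hi *.
rewrite !maxEle; case: ifP; have := A0 j; lra.
Qed.

(** * Assigning blocks under tail domination *)

Lemma tail_sum (R : realType) (A g : R^nat) l r :
    (forall j, g j = A j + g j.+1) -> (l <= r)%N ->
  \sum_(l <= j < r) A j = g l - g r.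
Proof.
move=> gE lr; rewrite -opprB -(telescope_sumr g lr) -sumrN.
by apply: eq_bigr => j _; rewrite opprB gE addrK.
Qed.

Lemma tail_noninc (R : realType) (A g : R^nat) m n :
    (forall k, 0 <= A k) -> (forall j, g j = A j + g j.+1) -> (m <= n)%N ->
  g n <= g m.
Proof. by move=> A0 gE mn; rewrite -subr_ge0 -(tail_sum gE mn) sumr_ge0. Qed.

(** Here g and h stand for the tail sums of A and B. The block of k is {k} when
    B k <= 2 A k. Otherwise it is the set of j with
    h (k+1) + B k / 4 < g j <= h k; these sets are disjoint, and the quarter
    cut off at the far end keeps each of them finite even when h (k+1) = 0.
    If h k <= g k, the first tail of g not above h k is at least h k - B k / 2,
    because the entry crossed to reach it, if there is one at or after k, is
    less than B k / 2. Hence the block has sum at least B k / 4. *)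
Lemma tail_assignment (R : realType) (A B g h : R^nat) :
    (forall k, 0 <= A k) -> (forall m n, (m <= n)%N -> A n <= A m) ->
    (forall k, 0 <= B k) ->
    (forall j, g j = A j + g j.+1) -> (forall k, h k = B k + h k.+1) ->
    (forall k, 0 <= h k) ->
    (forall e, 0 < e -> exists j, g j <= e) ->
  exists l r : nat -> nat,
    (forall k, 0 < B k -> h k <= g k ->
       B k <= 4 * \sum_(l k <= j < r k) A j) /\
    (forall n j, \sum_(k < n) ((l k <= j < r k)%N : nat)%:R <= 2 :> R).
Proof.
move=> A0 dA B0 gE hE h0 g_small.
have dg m n := @tail_noninc R A g m n A0 gE.
have dh m n := @tail_noninc R B h m n B0 hE.
have spec k : exists lr : nat * nat,
    (0 < B k -> h k <= g k -> B k <= 4 * \sum_(lr.1 <= j < lr.2) A j) /\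
    (forall j, (lr.1 <= j < lr.2)%N -> j = k \/ h k.+1 < g j <= h k).
  have [Bk|Bk] := ltP 0 (B k); last first.
    by exists (0, 0)%N; split=> // j; rewrite ltn0 andbF.
  have [small|big] := leP (B k) (2 * A k).
    exists (k, k.+1); split=> [_ _|j /=] /=.
      by rewrite big_nat1; have := A0 k; lra.
    by rewrite ltnS -eqn_leq => /eqP; left.
  have lex : exists j, g j <= h k.
    by apply: g_small; rewrite hE; have := h0 k.+1; lra.
  have rex : exists j, g j <= h k.+1 + B k / 4.
    by apply: g_small; have := h0 k.+1; lra.
  have [l gl lmin] := ex_minnP lex; have [r gr rmin] := ex_minnP rex.
  exists (l, r); split=> [_ hgk|j /= /andP[lj jr]] /=; last first.
    right; rewrite (le_trans (dg _ _ lj) gl) andbT ltNge; apply/negP => gj.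
    suff /rmin : g j <= h k.+1 + B k / 4 by rewrite leqNgt jr.
    lra.
  have lr : (l <= r)%N by apply: lmin; rewrite hE; lra.
  rewrite (tail_sum gE lr).
  suff : h k - B k / 2 <= g l by have := hE k; lra.
  have [lk|kl] := leqP l k; first by have := dg _ _ lk; lra.
  (* Beyond k, the entry A (l-1) just crossed is at most A k < B k / 2. *)
  case: l lmin gl lr kl => // l lmin _ _ kl.
  have : ~~ (g l <= h k) by apply/negP => /lmin; rewrite ltnn.
  have := dA k l kl; have := gE l; rewrite -ltNge; lra.
have [lr hlr] := choice spec.
exists (fun k => (lr k).1), (fun k => (lr k).2); split=> [k|n j].
  by have [] := hlr k.
(* Each of the two kinds of block contains j for at most one k. *)
apply: (@le_trans _ _
  (\sum_(k < n) ((j == k)%:R + (h k.+1 < g j <= h k)%R%:R))).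
  apply: ler_sum => k _; case: (boolP (_ <= _ < _)%N) => [jk|_]; last first.
    by rewrite addr_ge0.
  have [_ /(_ j jk)[->|->]] := hlr k; first by rewrite eqxx lerDl.
  by rewrite lerDr.
rewrite big_split -[leRHS]/(1 + 1) lerD//=.
  by apply: (@sum_indicator_le1 _ (fun k => j == k)) => k m /eqP <- /eqP.
apply: (@sum_indicator_le1 _ (fun k => h k.+1 < g j <= h k)).
have disj k m : h k.+1 < g j <= h k -> h m.+1 < g j <= h m -> (k <= m)%N.
  move=> /andP[_ hk] /andP[hm _]; rewrite leqNgt; apply/negP => mk.
  by have := dh _ _ mk; lra.
by move=> k m kj mj; apply/eqP; rewrite eqn_leq !disj.
Qed.

(** * Averaging over blocks *)

(** Jensen's inequality for t^q. With m the weighted mean, Young's inequality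
    for t i and m^(q-1) is the tangent line bound of t^q at m, and the weighted
    sum of the tangent bounds is the claim. *)
Lemma power_mean (R : realType) (I : Type) (s : seq I) (w t : I -> R) (q : R) :
    1 <= q -> (forall i, 0 <= w i) -> (forall i, 0 <= t i) ->
    0 < \sum_(i <- s) w i ->
  ((\sum_(i <- s) w i * t i) / \sum_(i <- s) w i) `^ q <=
  (\sum_(i <- s) w i * t i `^ q) / \sum_(i <- s) w i.
Proof.
move=> q1 w0 t0; set W := \sum_(i <- s) w i => W0.
set m := _ / W.
have m0 : 0 <= m.
  by rewrite divr_ge0 ?(ltW W0)// sumr_ge0// => i _; rewrite mulr_ge0.
have [->|qn1] := eqVneq q 1.
  by rewrite powRr1//; under [in leRHS]eq_bigr do rewrite powRr1//.
have q_gt1 : 1 < q by rewrite lt_neqAle eq_sym qn1.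
set q' := q / (q - 1).
have qq' : q^-1 + q'^-1 = 1 by rewrite /q'; field; lra.
have young i : t i * m `^ (q - 1) <= t i `^ q / q + m `^ q / q'.
  have -> : m `^ q = (m `^ (q - 1)) `^ q'.
    by rewrite -powRrM /q' mulrCA divff ?mulr1//; lra.
  apply: conjugate_powR; rewrite ?powR_ge0// ?divr_gt0//; lra.
have : \sum_(i <- s) w i * (t i * m `^ (q - 1)) <=
    \sum_(i <- s) w i * (t i `^ q / q + m `^ q / q').
  by apply: ler_sum => i _; rewrite ler_wpM2l.
under eq_bigr do rewrite mulrA.
rewrite -mulr_suml.
have -> : \sum_(i <- s) w i * t i = m * W by rewrite /m divfK ?gt_eqF.
under eq_bigr do rewrite mulrDr mulrA.
rewrite big_split /= -!mulr_suml -/W.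
have -> : m * W * m `^ (q - 1) = m `^ q * W.
  have [->|mn0] := eqVneq m 0; first by rewrite !powR0 ?mul0r//; lra.
  rewrite mulrAC -{1}[m](powRr1 m0) -powRD; last by rewrite mn0 implybT.
  by rewrite addrC subrK.
rewrite ler_pdivlMr//.
have -> : q'^-1 = 1 - q^-1 by lra.
have : 0 < q^-1 by rewrite invr_gt0; lra.
set a := q^-1; set M := m `^ q * W; set Z := \sum_(i <- s) _ => a0 le.
rewrite -(ler_pM2l a0).
by move: le; rewrite mulrA (mulrC W) -/M; lra.
Qed.

(** On the rows in K, this is b k times the average of u / a over the block of
    k with weights a^q, so it sends a to b there as long as a does not vanish on
    the block. The quotient u j / a j
    is 0 when a j = 0, harmlessly since the weight vanishes too. *)
Definition block_avg (R : realType) (q : R) (a b : R^nat) (K : pred nat)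
    (l r : nat -> nat) (u : R^nat) : R^nat := fun k =>
  if K k then b k * ((\sum_(l k <= j < r k) a j `^ q * (u j / a j)) /
                     \sum_(l k <= j < r k) a j `^ q)
  else 0.

Lemma block_avg_linear (R : realType) (q : R) (a b : R^nat) (K : pred nat)
    (l r : nat -> nat) (c : R) (u v : R^nat) :
  block_avg q a b K l r (c *: u + v) =
  c *: block_avg q a b K l r u + block_avg q a b K l r v.
Proof.
apply/funext => k; rewrite /block_avg !fctE /=; case: (K k); last first.
  by rewrite scaler0 addr0.
have -> : \sum_(l k <= j < r k) a j `^ q * ((c * u j + v j) / a j) =
    c * (\sum_(l k <= j < r k) a j `^ q * (u j / a j)) +
    \sum_(l k <= j < r k) a j `^ q * (v j / a j).
  by rewrite mulr_sumr -big_split; apply: eq_bigr => j _ /=; ring.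
by rewrite /GRing.scale /=; ring.
Qed.

Lemma sum_block (R : realType) (l r : nat) (f : R^nat) :
  \sum_(j < r) ((l <= j < r)%N : nat)%:R * f j = \sum_(l <= j < r) f j.
Proof.
rewrite big_geq_mkord [RHS]big_mkcond; apply: eq_bigr => j _ /=.
by rewrite ltn_ord andbT; case: leqP; rewrite ?mul1r ?mul0r.
Qed.

Lemma block_avg_id (R : realType) (q : R) (a b : R^nat) (K : pred nat)
    (l r : nat -> nat) k : 0 < q -> K k ->
    0 < \sum_(l k <= j < r k) a j `^ q -> block_avg q a b K l r a k = b k.
Proof.
move=> q0 Kk W0; rewrite /block_avg Kk.
have -> : \sum_(l k <= j < r k) a j `^ q * (a j / a j) =
    \sum_(l k <= j < r k) a j `^ q.
  apply: eq_bigr => j _; have [->|aj] := eqVneq (a j) 0.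
    by rewrite powR0 ?gt_eqF// mul0r.
  by rewrite divff// mulr1.
by rewrite divff ?gt_eqF// mulr1.
Qed.

(** By [power_mean], the q-th power of row k is at most
    (b k)^q / (sum of a^q over the block) times the sum of |u|^q over the block,
    so the column test applies with entries C on the blocks. *)
Lemma block_avg_lnorm (R : realType) (q C : R) (a b : R^nat) (K : pred nat)
    (l r : nat -> nat) (M : R) (u : R^nat) : 1 <= q -> 0 <= C ->
    (forall k, 0 <= a k) -> (forall k, K k -> 0 < b k) ->
    (forall k, K k -> b k `^ q <= C * \sum_(l k <= j < r k) a j `^ q) ->
    (forall n j, \sum_(k < n) ((l k <= j < r k)%N : nat)%:R <= M :> R) ->
  (lnorm q%:E (block_avg q a b K l r u) <=
   ((C * M) `^ q^-1)%:E * lnorm q%:E u)%E.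
Proof.
move=> q1 C0 a0 b0 bC lrM; have q0 : 0 < q by lra.
apply: (schur_lnorm (c := fun k j => C * ((l k <= j < r k)%N : nat)%:R)
  (N := r)) => //.
- by move=> k j; rewrite mulr_ge0.
- move=> k; under eq_bigr do rewrite -mulrA.
  rewrite -mulr_sumr (sum_block _ _ (fun j => `|u j| `^ q)).
  have s0 : 0 <= C * \sum_(l k <= j < r k) `|u j| `^ q.
    by rewrite mulr_ge0// sumr_ge0// => *; rewrite powR_ge0.
  rewrite /block_avg; case: ifP => [Kk|_]; last by rewrite normr0 powR0 ?gt_eqF.
  set W := \sum_(l k <= j < r k) a j `^ q.
  have W0 : 0 < W.
    have Bq : 0 < b k `^ q by rewrite powR_gt0 ?b0.
    have /(lt_le_trans Bq) := bC k Kk.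
    by rewrite -/W lt_def mulf_eq0 => /andP[/norP[_ Wn] _]; rewrite lt_def Wn
      sumr_ge0// => *; rewrite powR_ge0.
  rewrite normrM (gtr0_norm (b0 k Kk)) powRM// ?(ltW (b0 k Kk))//.
  apply: (@le_trans _ _ (C * W * ((\sum_(l k <= j < r k) `|u j| `^ q) / W)));
    last by rewrite -mulrA (mulrC W) divfK ?gt_eqF.
  apply: ler_pM; rewrite ?powR_ge0 ?bC//.
  rewrite normrM normfV (gtr0_norm W0).
  apply: (@le_trans _ _
    (((\sum_(l k <= j < r k) a j `^ q * (`|u j| / a j)) / W) `^ q)).
    rewrite ge0_ler_powR ?nnegrE ?(ltW q0)//.
    + by rewrite divr_ge0 ?(ltW W0).
    + rewrite divr_ge0 ?(ltW W0)// sumr_ge0// => j _.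
      by rewrite mulr_ge0 ?powR_ge0// divr_ge0.
    rewrite ler_pM2r ?invr_gt0//; apply: le_trans (ler_norm_sum _ _ _) _.
    apply: ler_sum => j _; rewrite !normrM normfV (ger0_norm (powR_ge0 _ _)).
    by rewrite (ger0_norm (a0 j)).
  apply: le_trans (power_mean q1 _ _ W0) _ => [j|j|].
  - exact: powR_ge0.
  - by rewrite divr_ge0.
  rewrite ler_pM2r ?invr_gt0//; apply: ler_sum => j _.
  have [->|aj] := eqVneq (a j) 0.
    by rewrite powR0 ?gt_eqF// mul0r powR_ge0.
  by rewrite -powRM ?divr_ge0// mulrC divfK.
- by move=> n j; rewrite -mulr_sumr ler_wpM2l.
Qed.

Lemma block_avg_lnorm0 (R : realType) (q : R) (a b : R^nat) (K : pred nat)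
    (l r : nat -> nat) (M : R) (u : R^nat) :
    (forall n j, \sum_(k < n) ((l k <= j < r k)%N : nat)%:R <= M :> R) ->
  (lnorm 0%E (block_avg q a b K l r u) <= M%:E * lnorm 0%E u)%E.
Proof.
move=> lrM; rewrite !lnorm0E.
apply: (schur_test (c := fun k j => ((l k <= j < r k)%N : nat)%:R)
  (N := r)) => //.
move=> k /=; rewrite (sum_block _ _ (fun j => (u j != 0)%:R)).
have [_|nz] := eqVneq (block_avg q a b K l r u k) 0.
  by rewrite sumr_ge0.
have [j /andP[lj jr] uj] : exists2 j, (l k <= j < r k)%N & u j != 0.
  apply: contrapT => h; move/eqP: nz; apply; rewrite /block_avg.
  case: ifP => // _; rewrite [X in X / _]big_nat_cond big1 ?mul0r ?mulr0//.
  move=> j; rewrite andbT => lrj; have [->|uj] := eqVneq (u j) 0.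
    by rewrite mul0r mulr0.
  by exfalso; apply: h; exists j.
rewrite (big_cat_nat lj (ltnW jr))/= (big_ltn jr) uj.
by rewrite addrCA lerDl addr_ge0// sumr_ge0.
Qed.

(** * Decreasing enumeration of a null sequence *)

Lemma max_outside (R : realType) (u : R^nat) (s : seq nat) :
    (forall e, 0 < e -> exists N, forall n, (N <= n)%N -> `|u n| < e) ->
  exists i, i \notin s /\ forall j, j \notin s -> `|u j| <= `|u i|.
Proof.
move=> u0.
have [[i0 [is0 ui0]]|allz] := pselect (exists i, i \notin s /\ u i != 0).
  have [N hN] : exists N, forall n, (N <= n)%N -> `|u n| < `|u i0|.
    by apply: u0; rewrite normr_gt0.
  have iN : (i0 < N)%N by rewrite ltnNge; apply/negP => /hN; rewrite ltxx.
  pose o0 := Ordinal iN.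
  have := @arg_maxP _ _ _ o0 (fun i : 'I_N => val i \notin s)
    (fun i : 'I_N => `|u i|) is0.
  case=> i /= si imax; exists i; split=> // j sj.
  have [jN|/hN/ltW/le_trans] := ltnP j N; first exact: (imax (Ordinal jN)).
  by apply; exact: (imax o0).
have fresh : (\max_(j <- s) j).+1 \notin s.
  apply/negP => /(@leq_bigmax_seq _ s xpredT id)/(_ isT).
  by rewrite ltnn.
exists (\max_(j <- s) j).+1; split=> // j sj.
have [->|uj] := eqVneq (u j) 0; first by rewrite normr0.
by exfalso; apply: allz; exists j.
Qed.

(** Choose greedily: sigma n is a place of maximal modulus outside
    sigma 0, ..., sigma (n-1). A place where u is nonzero is eventually chosen,
    since otherwise infinitely many places would carry moduli bounded below.
    The infimum defining [rearr] is attained at the first k places, because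
    any other set of k places misses one of the first k+1. *)
Lemma decreasing_enumeration (R : realType) (u : R^nat) :
    (forall e, 0 < e -> exists N, forall n, (N <= n)%N -> `|u n| < e) ->
  exists sigma rho : nat -> nat,
    [/\ cancel sigma rho,
        forall i, u i != 0 -> sigma (rho i) = i,
        forall m n, (m <= n)%N -> `|u (sigma n)| <= `|u (sigma m)|
      & forall k, rearr u k.+1 = `|u (sigma k)| ].
Proof.
move=> u0; have [next hnext] := choice (fun s => max_outside s u0).
pose pre n := iter n (fun s => rcons s (next s)) [::].
pose sigma n := next (pre n).
have preE n : pre n = [seq sigma i | i <- iota 0 n].
  by elim: n => // n ih; rewrite -[in RHS]addn1 iotaD map_cat -ih add0n cats1.
have sigma_notin n : sigma n \notin pre n by have [] := hnext (pre n).
have sigma_max n j : j \notin pre n -> `|u j| <= `|u (sigma n)|.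
  by have [_] := hnext (pre n); exact.
have mem_pre m n : (m < n)%N -> sigma m \in pre n.
  by move=> mn; rewrite preE; apply/map_f; rewrite mem_iota.
have sigma_inj : injective sigma.
  move=> m n mn; case: (ltngtP m n) => // lt.
    by have := sigma_notin n; rewrite -mn mem_pre.
  by have := sigma_notin m; rewrite mn mem_pre.
have notin_pre m n : (m <= n)%N -> sigma n \notin pre m.
  move=> mn; rewrite preE; apply/mapP => -[i]; rewrite mem_iota /= => im.
  by move/sigma_inj => ni; move: im; rewrite -ni ltnNge mn.
have dec m n : (m <= n)%N -> `|u (sigma n)| <= `|u (sigma m)|.
  by move=> /notin_pre/sigma_max.
have onto i : u i != 0 -> exists n, sigma n = i.
  move=> ui; apply: contrapT => h.
  have ige n : `|u i| <= `|u (sigma n)|.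
    apply: sigma_max; rewrite preE; apply/mapP => -[m _ im].
    by apply: h; exists m.
  have [N hN] : exists N, forall n, (N <= n)%N -> `|u n| < `|u i|.
    by apply: u0; rewrite normr_gt0.
  have sN n : (sigma n < N)%N.
    by rewrite ltnNge; apply/negP => /hN; rewrite ltNge ige.
  have : (size (pre N.+1) <= size (iota 0 N))%N.
    apply: uniq_leq_size; first by rewrite preE map_inj_uniq ?iota_uniq.
    by move=> j; rewrite preE => /mapP[m _ ->]; rewrite mem_iota /= sN.
  by rewrite preE size_map !size_iota ltnn.
have spec i : exists m, (exists n, sigma n = i) -> sigma m = i.
  by have [[n <-]|h] := pselect (exists n, sigma n = i); [exists n|exists 0%N].
have [rho hrho] := choice spec.
exists sigma, rho; split=> //.
- by move=> n; apply: sigma_inj; apply: hrho; exists n.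
- by move=> i /onto; exact: hrho.
move=> k; rewrite /rearr /=.
have bnd (A : set nat) : has_ubound [set `|u i| | i in ~` A].
  by exists `|u (sigma 0)| => _ [i _ <-]; exact: (sigma_max 0%N).
have low : lbound [set sup [set `|u i| | i in ~` A] |
    A in [set A : set nat | (A #= `I_k)%card]] `|u (sigma k)|.
  move=> _ [A /= Ak <-].
  have [i ik Ai] : exists2 i, (i <= k)%N & ~ A (sigma i).
    apply: contrapT => h.
    have sub : sigma @` `I_k.+1 `<=` A.
      move=> _ [i /= ik <-]; apply: contrapT => Ai; apply: h.
      by exists i.
    have := subset_card_le sub.
    rewrite (card_le_eqr Ak).
    have /card_eqPle[_ le1] : (sigma @` `I_k.+1 #= `I_k.+1)%card.
      by apply: inj_card_eq => ? ? _ _ /sigma_inj.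
    by move=> /(card_le_trans le1); rewrite card_le_II ltnn.
  apply: le_trans (dec _ _ ik) _.
  by apply: ub_le_sup; [exact: bnd | exists (sigma i)].
have Ik : [set A : set nat | (A #= `I_k)%card] (sigma @` `I_k).
  by rewrite /=; apply: inj_card_eq => ? ? _ _ /sigma_inj.
apply/eqP; rewrite eq_le; apply/andP; split; last first.
  by apply: lb_le_inf low; exists (sup [set `|u i| | i in ~` (sigma @` `I_k)]);
    exists (sigma @` `I_k).
apply: (@le_trans _ _ (sup [set `|u i| | i in ~` (sigma @` `I_k)])).
  by apply: ge_inf; [exists `|u (sigma k)| | exists (sigma @` `I_k)].
apply: ge_sup.
  by exists `|u (sigma k)|, (sigma k) => // -[i /= ik /sigma_inj ?]; lia.
move=> _ [i /= Ai <-]; apply: sigma_max; rewrite preE; apply/mapP => -[m].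
by rewrite mem_iota /= => mk im; apply: Ai; exists m.
Qed.

(** * Rearrangements and tails of summable sequences *)

Lemma summable_tails (R : realType) (F : R^nat) :
    (forall k, 0 <= F k) -> (\sum_(k <oo) (F k)%:E < +oo)%E ->
  exists g : R^nat,
    [/\ forall j, (\sum_(j <= k <oo) (F k)%:E = (g j)%:E)%E,
        forall j, g j = F j + g j.+1,
        forall j, 0 <= g j
      & forall e, 0 < e -> exists N, forall n, (N <= n)%N -> g n <= e].
Proof.
move=> F0 Foo.
have E0 k : (0 <= (F k)%:E)%E by rewrite lee_fin.
have tail_fin j : (\sum_(j <= k <oo) (F k)%:E)%E \is a fin_num.
  rewrite ge0_fin_numE ?nneseries_ge0//; apply: le_lt_trans Foo.
  rewrite [leRHS](nneseries_split 0 j)//.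
  by rewrite add0n leeDr// sume_ge0.
pose g j := fine (\sum_(j <= k <oo) (F k)%:E)%E.
have gP j : (\sum_(j <= k <oo) (F k)%:E = (g j)%:E)%E by rewrite fineK.
exists g; split=> //.
- move=> j; apply: EFin_inj; rewrite EFinD -!gP.
  by rewrite (nneseries_split j 1)// addn1 big_nat1.
- by move=> j; rewrite -lee_fin -gP nneseries_ge0.
have cg : g @ \oo --> (0 : R).
  apply: fine_cvg; apply: nneseries_tail_cvg => //.
move=> e e0; move/cvgrPdist_le : cg => /(_ _ e0)[N _ hN].
exists N => n Nn; have := hN n Nn; rewrite sub0r normrN.
exact: le_trans (ler_norm _).
Qed.

Lemma ell_summable (R : realType) (q : R) (u : R^nat) : 0 < q ->
  ell q%:E u -> (\sum_(k <oo) (`|u k| `^ q)%:E < +oo)%E.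
Proof.
move=> q0; rewrite /ell /= lnormE// => h.
by apply: lty_poweRy h; rewrite invr_neq0 ?gt_eqF.
Qed.

Lemma ell_small (R : realType) (q : R) (u : R^nat) : 0 < q -> ell q%:E u ->
  forall e, 0 < e -> exists N, forall n, (N <= n)%N -> `|u n| < e.
Proof.
move=> q0 /(ell_summable q0) /summable_tails.
case=> [k|g [_ gE g0 gs] e e0]; first exact: powR_ge0.
have e20 : 0 < e / 2 by lra.
have [N hN] := gs _ (powR_gt0 q e20).
exists N => n Nn; rewrite ltNge; apply/negP => eu.
have := hN n Nn; rewrite leNgt => /negP; apply.
apply: (@lt_le_trans _ _ (`|u n| `^ q)); last by rewrite gE lerDl.
by rewrite gt0_ltr_powR ?nnegrE//; lra.
Qed.

(** Collects what the decomposition needs to know about the rearrangement of u.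
    Positions in [head_tail] count from 1, so its tail at n+1 is g n. *)
Lemma head_tail_enumeration (R : realType) (q : R) (u : R^nat) :
    0 < q -> ell q%:E u ->
  exists (sigma rho : nat -> nat) (g : R^nat),
    [/\ cancel sigma rho,
        forall i, u i != 0 -> sigma (rho i) = i,
        forall m n, (m <= n)%N -> `|u (sigma n)| <= `|u (sigma m)|
      & [/\ forall j, g j = `|u (sigma j)| `^ q + g j.+1,
        forall j, 0 <= g j,
        forall e, 0 < e -> exists j, g j <= e
      & forall p alpha n, head_tail p q alpha u n.+1 =
          (psum (fun k => `|u (sigma k)| `^ p) n.+1 `^ p^-1 +
           n.+1%:R `^ alpha^-1 * g n `^ q^-1)%:E]].
Proof.
move=> q0 uq.
have [sigma [rho [sK rK dec rE]]] := decreasing_enumeration (ell_small q0 uq).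
have us : ell q%:E (wcomp (fun=> 1) sigma u).
  apply: le_lt_trans uq; apply: wcomp_contraction.
  - by rewrite lee_fin ltW.
  - by move=> k; rewrite normr1.
  - by move=> k l _ _ /(can_inj sK).
have := ell_summable q0 us; rewrite /wcomp.
under eq_eseriesr do rewrite mul1r.
case/summable_tails => [k|g [gP gE g0 gs]]; first exact: powR_ge0.
exists sigma, rho, g; split=> //; split=> //.
  by move=> e /gs[N hN]; exists N; exact: hN.
move=> p alpha n; rewrite /head_tail EFinD EFinM; congr ((_ `^ _)%:E + _ * _)%E.
  rewrite big_add1 /= big_mkord; apply: eq_bigr => k _.
  by rewrite rE.
rewrite -poweR_EFin -gP -(nneseries_addn n.+1); last first.
  by move=> k; rewrite lee_fin powR_ge0.
rewrite -(nneseries_addn n); last by move=> k; rewrite lee_fin powR_ge0.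
by congr poweR; apply: eq_eseriesr => k _; rewrite addnS rE.
Qed.

(** * The decomposition *)

(** If the head grows strictly from x to y, the tail cannot grow as well: both
    terms increase with their sums, and the weight is positive and the same on
    both sides. *)
Lemma head_or_tail (R : realType) (p q alpha hy hx gy gx : R) (n : nat) :
    0 < p -> 0 < q -> 0 <= hy -> 0 <= hx -> 0 <= gy -> 0 <= gx ->
    hy `^ p^-1 + n.+1%:R `^ alpha^-1 * gy `^ q^-1 <=
    hx `^ p^-1 + n.+1%:R `^ alpha^-1 * gx `^ q^-1 ->
  hx < hy -> gy <= gx.
Proof.
move=> p0 q0 hy0 hx0 gy0 gx0 le lt; rewrite leNgt; apply/negP => lt'.
have h1 : hx `^ p^-1 < hy `^ p^-1 by rewrite gt0_ltr_powR ?nnegrE ?invr_gt0.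
have h2 : gx `^ q^-1 < gy `^ q^-1 by rewrite gt0_ltr_powR ?nnegrE ?invr_gt0.
have h3 : 0 < n.+1%:R `^ alpha^-1 :> R by rewrite powR_gt0 ?ltr0n.
move: h2; rewrite -(ltr_pM2l h3); lra.
Qed.

Lemma powR_inv_le (R : realType) (p a b C : R) : 0 < p -> 0 <= a -> 0 <= C ->
  0 < b -> a `^ p <= C * b `^ p -> a / b <= C `^ p^-1.
Proof.
move=> p0 a0 C0 b0 ab.
have bp : 0 < b `^ p by rewrite powR_gt0.
rewrite ler_pdivrMr//.
have -> : a = (a `^ p) `^ p^-1 by rewrite -powRrM mulfV ?gt_eqF// powRr1.
have -> : C `^ p^-1 * b = (C * b `^ p) `^ p^-1.
  by rewrite powRM ?powR_ge0// -powRrM mulfV ?gt_eqF// powRr1// ltW.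
rewrite ge0_ler_powR ?nnegrE ?powR_ge0 ?mulr_ge0 ?powR_ge0//.
by rewrite invr_ge0 ltW.
Qed.

Theorem theorem4p5 (R : realType) (p q alpha : R)
  (p_gt0 : 0 < p) (lt_pq : p < q) (q_ge1 : 1 <= q)
  (alphaE : alpha^-1 = p^-1 - q^-1)
  (x y : R^nat) (xq : ell q%:E x) (yq : ell q%:E y)
  (le_yx : forall n : nat, (0 < n)%N ->
     (head_tail p q alpha y n <= head_tail p q alpha x n)%E) :
  exists T S : R^nat -> R^nat,
    [/\ couple_bounded p%:E +oo%E T,
        (couple_norm p%:E +oo%E T <= (8 `^ p^-1)%:E)%E,
        couple_bounded 0%E q%:E S,
        (couple_norm 0%E q%:E S <= 18%:E)%E
      & y = T x + S x].
Proof.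
have q_gt0 : 0 < q by lra.
have [sx [rx [gx [sxK rxK dx [gxE gx0 gx_small htx]]]]] :=
  head_tail_enumeration q_gt0 xq.
have [sy [ry [gy [syK ryK dy [gyE gy0 gy_small hty]]]]] :=
  head_tail_enumeration q_gt0 yq.
pose a k := `|x (sx k)|; pose b k := `|y (sy k)|.
have a0 k : 0 <= a k by exact: normr_ge0.
have b0 k : 0 <= b k by exact: normr_ge0.
have pow_dec r (c : R^nat) : 0 < r -> (forall k, 0 <= c k) ->
    (forall m n, (m <= n)%N -> c n <= c m) ->
    forall m n, (m <= n)%N -> c n `^ r <= c m `^ r.
  by move=> r0 c0 dc m n mn; rewrite ge0_ler_powR ?nnegrE ?dc// ltW.
pose A k := a k `^ p; pose B k := b k `^ p.
have A0 k : 0 <= A k by exact: powR_ge0.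
have B0 k : 0 <= B k by exact: powR_ge0.
have [tau [tauP tau_load]] :=
  head_assignment A0 B0 (pow_dec _ _ p_gt0 a0 dx) (pow_dec _ _ p_gt0 b0 dy).
have [l [r [lrP lr2]]] := tail_assignment (fun k => powR_ge0 (a k) q)
  (pow_dec _ _ q_gt0 a0 dx) (fun k => powR_ge0 (b k) q) gxE gyE gy0 gx_small.
pose K k := ~~ head_dominated A B k && (0 < b k).
have KP k : K k -> 0 < b k `^ q /\ gy k <= gx k.
  move=> /andP[]; rewrite /head_dominated negb_and => Kk bk.
  rewrite powR_gt0//; split=> //; move: Kk; rewrite powR_gt0//= -ltNge.
  apply: (@head_or_tail _ p q alpha _ _ _ _ k) => //; try exact: sumr_ge0.
  by have := le_yx k.+1 isT; rewrite htx hty lee_fin.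
pose t k := if head_dominated A B k then b k / a (tau k) else 0.
pose P := wcomp (fun k => Num.sg (x (sx k))) sx.
pose Q := wcomp (fun i => Num.sg (y i)) ry.
have sg_le1 (z : R) : `|Num.sg z| <= 1 by rewrite normr_sg lern1 leq_b1.
have P_le s u : (0 <= s)%E -> (lnorm s (P u) <= lnorm s u)%E.
  by move=> s0; apply: wcomp_contraction => // k m _ _ /(can_inj sxK).
have Q_le s u : (0 <= s)%E -> (lnorm s (Q u) <= lnorm s u)%E.
  move=> s0; apply: wcomp_contraction => // i j.
  by rewrite !sgr_eq0 => /ryK {2}<- /ryK {2}<- ->.
(* V acts between the rearrangements; P and Q increase no norm. *)
have QPx (V : R^nat -> R^nat) s (C : R) : (0 <= s)%E -> 0 <= C ->
    (forall u, lnorm s (V u) <= C%:E * lnorm s u)%E ->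
    (forall u, lnorm s (Q (V (P u))) <= C%:E * lnorm s u)%E.
  move=> s0 C0 VC u; apply: le_trans (Q_le _ _ s0) _.
  apply: le_trans (VC _) _; rewrite lee_wpmul2l ?lee_fin//.
  exact: P_le.
pose T u := Q (wcomp t tau (P u)).
pose S u := Q (block_avg q a b K l r (P u)).
have linT c u v : T (c *: u + v) = c *: T u + T v.
  by rewrite /T /P /Q !wcomp_linear.
have linS c u v : S (c *: u + v) = c *: S u + S v.
  by rewrite /S /P /Q wcomp_linear block_avg_linear wcomp_linear.
have p0 : (0 <= p%:E)%E by rewrite lee_fin ltW.
have q0 : (0 <= q%:E)%E by rewrite lee_fin ltW.
have y0 : (0 <= +oo :> \bar R)%E by [].
have C80 : 0 <= 8 `^ p^-1 :> R by exact: powR_ge0.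
have Tp u : (lnorm p%:E (T u) <= (8 `^ p^-1)%:E * lnorm p%:E u)%E.
  move: u; apply: QPx => // u; apply: wcomp_lnorm => // n j.
  have [Aj|Aj] := ltP 0 (A j); last first.
    rewrite big1 // => k /eqP tk; rewrite /t; case: ifPn => [/tauP[]|_].
      by rewrite tk ltNge Aj.
    by rewrite normr0 powR0 ?gt_eqF.
  have :
      (\sum_(k < n | head_dominated A B k && (tau k == j)) B k) / A j <= 8.
    rewrite ler_pdivrMr//; apply: le_trans (tau_load n j) _.
    by rewrite ler_pM2r// ler_nat.
  apply: le_trans; rewrite mulr_suml [leRHS]big_mkcond [leLHS]big_mkcond.
  apply: ler_sum => k _; rewrite andbC /t; case: eqP => //= <-.
  case: ifP => _; last by rewrite normr0 powR0 ?gt_eqF.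
  by rewrite normrM normfV !ger0_norm// powRM ?invr_ge0//
    -(powR_inv1 (a0 _)) powRAC powR_inv1 ?powR_ge0.
have Ty u : (lnorm +oo (T u) <= (8 `^ p^-1)%:E * lnorm +oo u)%E.
  move: u; apply: QPx => // u; apply: wcomp_lnormy => // k.
  rewrite /t; case: ifPn => [gk|_]; last by rewrite normr0.
  have [Ak Bk] := tauP k gk.
  have ak := gt0_powR p_gt0 (a0 _) Ak.
  rewrite normrM normfV !ger0_norm//; apply: powR_inv_le => //.
  by apply: le_trans Bk _; rewrite -/(A _); lra.
have Kb k : K k -> 0 < b k by case/andP.
have KB k : K k -> b k `^ q <= 4 * \sum_(l k <= j < r k) a j `^ q.
  by move=> /KP[]; exact: lrP.
have Sq u : (lnorm q%:E (S u) <= 18%:E * lnorm q%:E u)%E.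
  move: u; apply: QPx => // u.
  apply: le_trans (block_avg_lnorm u q_ge1 _ a0 Kb KB lr2) _ => //.
  apply: lee_wpmul2r; first by rewrite lnormE// poweR_ge0.
  rewrite lee_fin; apply: le_trans (_ : 4 * 2 <= _); last by lra.
  by apply: ler1_powR; [lra | rewrite invf_le1].
have S0 u : (lnorm 0 (S u) <= 18%:E * lnorm 0 u)%E.
  move: u; apply: QPx => // u.
  apply: le_trans (block_avg_lnorm0 q a b K u lr2) _.
  apply: lee_wpmul2r; last by rewrite lee_fin ler_nat.
  by rewrite lnorm0E nneseries_ge0// => k _ _; rewrite lee_fin.
have c18 : 0 <= 18 :> R by [].
exists T, S; split.
- by split; [exact: bounded_onI C80 linT Ty | exact: bounded_onI C80 linT Tp].
- by rewrite /couple_norm ge_max !opnorm_le.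
- by split; [exact: bounded_onI c18 linS Sq | exact: bounded_onI c18 linS S0].
- by rewrite /couple_norm ge_max !opnorm_le.
have Pa : P x = a.
  by apply/funext => k; rewrite /P /wcomp -normrEsg.
have Qb : Q b = y.
  apply/funext => i; rewrite /Q /wcomp; have [->|yi] := eqVneq (y i) 0.
    by rewrite sgr0 mul0r.
  by rewrite /b ryK// mulr_sg_norm.
rewrite -{1}Qb /T /S Pa /Q; apply/funext => i; rewrite !fctE /= /wcomp -mulrDr.
congr (_ * _); move: (ry i) => k.
have [good|bad] := boolP (head_dominated A B k).
  rewrite /block_avg /K good addr0 /t good divfK//.
  by have [/(gt0_powR p_gt0 (a0 _))] := tauP k good; rewrite lt_def => /andP[].
rewrite /t (negPf bad) mul0r add0r.
have [bk|] := ltP 0 (b k); last first.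
  rewrite le_eqVlt ltNge b0 orbF => /eqP bk.
  by rewrite /block_avg /K bad bk ltxx.
have Kk : K k by rewrite /K bad.
rewrite block_avg_id//.
by have := KB k Kk; have [/lt_le_trans h _] := KP k Kk; move=> /h; lra.
Qed.
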